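(* Let $s$ be a sufficiently large integer. Let $G^{(i)}=S(1,s)$ (a star with $s$ leaves) for every $1\le i\le t$, and let $G=G^{(1)}\square\cdots\square G^{(t)}$. Let $p=\frac{c}{t}$ where $c>\frac13$ is a constant. Then, with probability tending to $1$ as $t\to\infty$, the largest component of $G_p$ has order at least $|V(G)|^{1-s^{-1/6}}$.
   Context: For graphs $G^{(1)},\dots,G^{(t)}$, the Cartesian product $G=G^{(1)}\square\cdots\square G^{(t)}$ has vertex set $\{(v_1,\dots,v_t): v_i\in V(G^{(i)})\}$, with $uv$ an edge iff there is an $i$ such that $u_iv_i\in E(G^{(i)})$ and $u_j=v_j$ for all $j\ne i$. $S(1,s)$ is the star $K_{1,s}$. $G_p$ is the random subgraph of $G$ obtained by retaining each edge independently with probability $p$. *)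

(* Defs.v *)
From mathcomp Require Import all_boot all_order all_algebra.
From mathcomp Require Import reals.

Set Implicit Arguments.
Unset Strict Implicit.
Unset Printing Implicit Defensive.

Import Order.TTheory GRing.Theory Num.Theory.

Local Open Scope ring_scope.

Record sgraph := SGraph {
  vertex :> finType;
  adj : rel vertex;
  adj_sym : symmetric adj;
  adj_irrefl : irreflexive adj }.

(* S(1,s) = K_{1,s} on s + 1 vertices, with centre ord0. *)
Section Star.
Variable s : nat.

Definition star_adj : rel 'I_s.+1 :=
  fun u v => (u == ord0) (+) (v == ord0).

Lemma star_sym : symmetric star_adj.
Proof. by move=> u v; rewrite /star_adj addbC. Qed.

Lemma star_irrefl : irreflexive star_adj.
Proof. by move=> u; rewrite /star_adj addbb. Qed.

Definition star : sgraph := SGraph star_sym star_irrefl.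

End Star.

Section CartesianProduct.
Variables (t : nat) (G : 'I_t -> sgraph).

Definition box_vertex : finType := {dffun forall i : 'I_t, G i}.

Definition box_adj : rel box_vertex := fun u v =>
  [exists i : 'I_t,
    adj (u i) (v i) && [forall j : 'I_t, (j != i) ==> (u j == v j)]].

Lemma box_sym : symmetric box_adj.
Proof.
move=> u v; apply: eq_existsb => i; rewrite adj_sym; congr (_ && _).
by apply: eq_forallb => j; rewrite (eq_sym (u j)).
Qed.

Lemma box_irrefl : irreflexive box_adj.
Proof.
by move=> u; apply/existsP => -[i /andP[]]; rewrite adj_irrefl.
Qed.

Definition box : sgraph := SGraph box_sym box_irrefl.

End CartesianProduct.

Definition edges (G : sgraph) : {set {set G}} :=
  [set [set e.1; e.2] | e : G * G & adj e.1 e.2].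

Section SpanningSubgraph.
Variables (G : sgraph) (F : {set {set G}}).

Definition spanning_adj : rel G :=
  fun u v => adj u v && ([set u; v] \in F).

Lemma spanning_sym : symmetric spanning_adj.
Proof. by move=> u v; rewrite /spanning_adj adj_sym setUC. Qed.

Lemma spanning_irrefl : irreflexive spanning_adj.
Proof. by move=> u; rewrite /spanning_adj adj_irrefl. Qed.

Definition spanning : sgraph := SGraph spanning_sym spanning_irrefl.

End SpanningSubgraph.

Definition component (G : sgraph) (v : G) : {set G} :=
  [set w | connect (@adj G) v w].

Definition largest_component_order (G : sgraph) : nat :=
  \max_(v : G) #|component v|.

(* The probability that G_p satisfies A: the set F of retained edges has
   probability p^|F| (1 - p)^(|E(G)| - |F|). This is a genuine probability
   only when 0 <= p <= 1. *)
Definition percolation_prob (R : realType) (G : sgraph) (p : R)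
    (A : pred sgraph) : R :=
  \sum_(F : {set {set G}} | (F \subset edges G) && A (spanning F))
    p ^+ #|F| * (1 - p) ^+ #|edges G :\: F|.

(* Main.v *)
Require Import Defs.
From mathcomp Require Import all_boot all_order all_algebra reals.
From mathcomp Require Import ring lra zify.

Set Implicit Arguments.
Unset Strict Implicit.
Unset Printing Implicit Defensive.

Import Order.TTheory GRing.Theory Num.Theory.

Local Open Scope ring_scope.

(* Write [b = s + 1] and [delta = s ^ (-1/6)], and split the coordinates into
   three parts: [Rs] and [Sc] (of sizes [k] and [2k], with [k] about
   [delta t / 20]), and the rest [Z]. Fixing the coordinates in [Rs] gives
   [b ^ k] edge-disjoint copies of the same product, so it is enough that each
   copy contains a large component with probability much larger than
   [b ^ (- k)].

   Inside a copy, let the level of a vertex be its number of leaf coordinates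
   in [Z], and let the hub be the set of vertices of level 0, of which there
   are at most [b ^ (2k)]. A vertex with exactly [k] centres and [k] leaves
   among the coordinates in [Sc] reaches a vertex of the same shape one level
   down by three steps: centre to leaf in [Sc] ([s k] choices), leaf to centre
   in [Sc] ([k] choices), leaf to centre in [Z] ([n] choices at level [n]). The
   first step has so many choices, and the degree [s k] is so large compared to
   [t], that this succeeds with probability at least [n / (n + M)] where
   [M = O(t s ^ (-2/3))]; moreover it only uses edges that are fresh for the
   descent from level [n - 1]. Hence a vertex of maximal level reaches the hub
   with probability at least [1 / C(|Z| + M, M)], which is only
   [b ^ (- small t)]. In expectation, that fraction of the [s ^ |Z|] vertices of
   maximal level with a prescribed pattern on [Sc] is joined to the hub, and by
   the pigeonhole principle some hub vertex has a component of the required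
   order. *)

(** * Bernoulli random subsets *)

Section Percolation.
Variables (R : realFieldType) (T : finType) (p : R).
Hypotheses (p_ge0 : 0 <= p) (p_le1 : p <= 1).
Implicit Types (D F : {set T}) (A B : pred {set T}) (f g : {set T} -> R).

(** [D] is a parameter rather than the full edge set, so that disjoint blocks of edges can be
    revealed one after another. *)
Definition expect D f : R :=
  \sum_(F : {set T} | F \subset D) p ^+ #|F| * (1 - p) ^+ #|D :\: F| * f F.

Definition pr D A : R := expect D (fun F => (A F)%:R).

Definition increasing_event A : Prop :=
  forall F F' : {set T}, F \subset F' -> A F -> A F'.

Lemma expect_le D f g :
  (forall F, F \subset D -> f F <= g F) -> expect D f <= expect D g.
Proof.
move=> fg; apply: ler_sum => F FD; apply: ler_wpM2l (fg _ FD).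
by rewrite mulr_ge0 ?exprn_ge0 ?subr_ge0.
Qed.

Lemma expect_eq D f g : f =1 g -> expect D f = expect D g.
Proof. by move=> fg; apply: eq_bigr => F _; rewrite fg. Qed.

Lemma expectZ D (a : R) f : expect D (fun F => a * f F) = a * expect D f.
Proof. by rewrite mulr_sumr; apply: eq_bigr => F _; rewrite mulrCA. Qed.

Lemma expectD D f g :
  expect D (fun F => f F + g F) = expect D f + expect D g.
Proof. by rewrite -big_split; apply: eq_bigr => F _; rewrite mulrDr. Qed.

Lemma expect_sum (I : finType) (P : pred I) D (f : I -> {set T} -> R) :
  expect D (fun F => \sum_(i | P i) f i F) = \sum_(i | P i) expect D (f i).
Proof. by rewrite exchange_big; apply: eq_bigr => F _; rewrite mulr_sumr. Qed.

(** Fubini: [F] corresponds to the pair of its traces on [D2] and [D1], and the Bernoulli weights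
    multiply over disjoint sets. *)
Lemma expect_setU D1 D2 f : [disjoint D1 & D2] ->
  expect (D1 :|: D2) f =
  expect D2 (fun F2 => expect D1 (fun F1 => f (F1 :|: F2))).
Proof.
move=> dis; rewrite /expect.
under [RHS]eq_bigr do rewrite mulr_sumr.
rewrite pair_big /=.
rewrite (reindex_onto (fun q : {set T} * {set T} => q.2 :|: q.1)
  (fun F => (F :&: D2, F :&: D1))) /=; last first.
  by move=> F FD; rewrite -setIUr; apply/setIidPl.
have dI (F1 F2 E1 E2 : {set T}) : F1 \subset E1 -> F2 \subset E2 ->
    [disjoint E1 & E2] -> F1 :&: F2 = set0.
  move=> s1 s2 d; apply/eqP; rewrite setI_eq0.
  exact: disjointWl s1 (disjointWr s2 d).
have dis' : [disjoint D2 & D1] by rewrite disjoint_sym.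
apply: eq_big => [[F2 F1] /=|[F2 F1] /= /andP[sub /eqP[e2 e1]]].
  apply/andP/andP => [[_ /eqP[<- <-]]|[s2 s1]]; first by rewrite !subsetIr.
  split; first exact: setUSS.
  rewrite !setIUl (dI _ _ _ _ s1 (subxx D2) dis) (dI _ _ _ _ s2 (subxx D1) dis').
  by rewrite set0U setU0 (setIidPl s1) (setIidPl s2).
have s2 : F2 \subset D2 by rewrite -e2 subsetIr.
have s1 : F1 \subset D1 by rewrite -e1 subsetIr.
have cU (A B : {set T}) : A :&: B = set0 -> #|A :|: B| = (#|A| + #|B|)%N.
  by move=> AB; rewrite cardsU AB cards0 subn0.
have -> : (D1 :|: D2) :\: (F1 :|: F2) = (D1 :\: F1) :|: (D2 :\: F2).
  apply/setP => x; rewrite !inE; move/pred0P: (dis) => /(_ x) /=.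
  move: (subsetP s1 x) (subsetP s2 x).
  case: (x \in D1); case: (x \in D2); case: (x \in F1); case: (x \in F2);
  move=> //= h1 h2 h3; first [by have := h1 isT | by have := h2 isT].
rewrite !cU ?(dI _ _ _ _ s1 s2 dis) ?(dI _ _ _ _ (subsetDl _ _) (subsetDl _ _) dis) // !exprD.
by ring.
Qed.

Lemma pr_set1 (e : T) : pr [set e] (fun F => e \in F) = p.
Proof.
rewrite /pr /expect (bigD1 [set e]) //= big1 => [|F /andP[]].
  by rewrite setDv cards1 cards0 inE eqxx expr1 expr0 !mulr1 addr0.
rewrite subset1 => /orP[->//|/eqP-> _].
by rewrite inE mulr0.
Qed.

(** The weights have total mass 1: by induction on the cardinal of [D], each point splits off a
    factor [p + (1 - p)]. *)
Lemma expect_cst D (a : R) : expect D (fun=> a) = a.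
Proof.
have expect0 f : expect set0 f = f set0.
  rewrite /expect (bigD1 set0) ?sub0set //= big1 => [|F]; last first.
    by rewrite subset0 => /andP[->].
  by rewrite setD0 cards0; ring.
have [n] := ubnP #|D|; elim: n D => // n IH D.
have [->|[e eD]] := set_0Vmem D; first by rewrite expect0.
rewrite (cardsD1 e) eD add1n ltnS => /IH {}IH.
rewrite -(setD1K eD) setUC expect_setU; last first.
  by rewrite disjoint_sym disjoints1 !inE eqxx.
under expect_eq do rewrite IH.
rewrite /expect (bigD1 [set e]) //= (bigD1 set0) ?sub0set 1?eq_sym //=; last first.
  by rewrite -cards_eq0 cards1.
rewrite big1 => [|F].
  by rewrite setDv cards1 setD0 cards0 cards1; ring.
by rewrite subset1 => /andP[/andP[/orP[]->]].
Qed.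

Lemma pr_ge0 D A : 0 <= pr D A.
Proof.
rewrite -[leLHS](expect_cst D); apply: expect_le => F _; exact: ler0n.
Qed.

Lemma pr_le1 D A : pr D A <= 1.
Proof.
rewrite -[leRHS](expect_cst D); by apply: expect_le => F _; case: (A F).
Qed.

Lemma pr_le D A B :
  (forall F, F \subset D -> A F -> B F) -> pr D A <= pr D B.
Proof.
move=> AB; apply: expect_le => F /AB {}AB.
by rewrite ler_nat; case: (A F) AB => // ->.
Qed.

(* Revealing the edges of [D2] first and keeping those of [D1] fresh. *)
Lemma pr_setU_ge D1 D2 A B (rho : R) : [disjoint D1 & D2] ->
    (forall F2, F2 \subset D2 -> B F2 ->
       rho <= pr D1 (fun F1 => A (F1 :|: F2))) ->
  rho * pr D2 B <= pr (D1 :|: D2) A.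
Proof.
move=> dis AB; rewrite /pr expect_setU // -expectZ.
apply: expect_le => F2 F2D; have [BF|_] := boolP (B F2).
  by rewrite mulr1; apply: AB.
by rewrite mulr0; apply: pr_ge0.
Qed.

Lemma pr_subset D1 D2 A : increasing_event A -> D1 \subset D2 ->
  pr D1 A <= pr D2 A.
Proof.
move=> incA sub; rewrite -(setID D2 D1) (setIidPr sub) setUC.
rewrite -[leLHS]mul1r; apply: pr_setU_ge => [|F FD AF].
  by rewrite disjoints_subset setDE subsetIr.
rewrite -[leLHS](expect_cst (D2 :\: D1)); apply: expect_le => F' _.
by rewrite (incA F) ?subsetUr.
Qed.

Lemma pr_and D1 D2 A B : [disjoint D1 & D2] ->
    increasing_event A -> increasing_event B ->
  pr D1 A * pr D2 B <= pr (D1 :|: D2) (fun F => A F && B F).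
Proof.
move=> dis incA incB; apply: pr_setU_ge => // F2 _ BF2.
apply: pr_le => F1 _ AF1; apply/andP; split.
  exact: incA (subsetUl _ _) AF1.
exact: incB (subsetUr _ _) BF2.
Qed.

(** When [B] fails on [F2], [A] still has its full chance on the fresh set [D1]; monotonicity
    carries both events to the union. *)
Lemma pr_or D1 D2 A B : [disjoint D1 & D2] ->
    increasing_event A -> increasing_event B ->
  1 - (1 - pr D1 A) * (1 - pr D2 B) <= pr (D1 :|: D2) (fun F => A F || B F).
Proof.
move=> dis incA incB; rewrite /pr expect_setU //.
have -> : 1 - (1 - pr D1 A) * (1 - pr D2 B) =
    expect D2 (fun F2 => pr D1 A + (1 - pr D1 A) * (B F2)%:R).
  rewrite expectD expectZ expect_cst -/(pr D2 B); ring.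
apply: expect_le => F2 _; case BF2: (B F2).
  rewrite mulr1 addrC subrK -[leLHS](expect_cst D1).
  by apply: expect_le => F1 _; rewrite (incB F2) ?orbT ?subsetUr.
rewrite mulr0 addr0; apply: pr_le => F1 _ AF1.
by rewrite (incA F1) ?subsetUl.
Qed.

Lemma increasing_has (J : Type) (r : seq J) (A : J -> pred {set T}) :
  (forall j, increasing_event (A j)) ->
  increasing_event (fun F => has (A^~ F) r).
Proof.
by move=> incA F F' FF'; apply: sub_has => j /=; apply: incA.
Qed.

(** Iterates [pr_or]: by pairwise disjointness the tail of the list lives in [D0 :\: D j]. *)
Lemma pr_has (J : eqType) (r : seq J) (D : J -> {set T})
    (A : J -> pred {set T}) (D0 : {set T}) (q : R) :
    0 <= q <= 1 -> uniq r -> (forall j, increasing_event (A j)) ->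
    {in r, forall j, D j \subset D0} ->
    {in r, forall j, q <= pr (D j) (A j)} ->
    {in r &, forall i j, i != j -> [disjoint D i & D j]} ->
  1 - (1 - q) ^+ size r <= pr D0 (fun F => has (A^~ F) r).
Proof.
move=> /andP[q0 q1] + incA; elim: r D0 => [|j r IH] D0 /=.
  by move=> _ _ _ _; rewrite expr0 subrr pr_ge0.
move=> /andP[jr ur] sD qA dis.
have sDj : D j \subset D0 by apply: sD; rewrite mem_head.
have IHr : 1 - (1 - q) ^+ size r <= pr (D0 :\: D j) (fun F => has (A^~ F) r).
  apply: IH => // [i ir|i ir|i i' ir i'r]; last 2 first.
  - by apply: qA; rewrite inE ir orbT.
  - by apply: dis; rewrite inE ?ir ?i'r orbT.
  rewrite subsetD sD ?inE ?ir ?orbT //=; apply: dis; rewrite ?mem_head //.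
    by rewrite inE ir orbT.
  by apply: contraNneq jr => <-.
have djD : [disjoint D j & D0 :\: D j] by rewrite disjoint_sym disjoints_subset setDE subsetIr.
have := pr_or djD (incA j) (increasing_has (r := r) incA).
have -> : D j :|: D0 :\: D j = D0 by rewrite -{1}(setIidPr sDj) setID.
apply: le_trans; rewrite lerD2l lerN2 exprS; apply: ler_pM.
- by rewrite subr_ge0 pr_le1.
- by rewrite subr_ge0 pr_le1.
- by rewrite lerD2l lerN2 qA ?mem_head.
- by rewrite lerBlDl -lerBlDr.
Qed.
End Percolation.

(** * Percolation on products of stars *)

Section StarProduct.
Variables (s t : nat).

Let G : sgraph := box (fun _ : 'I_t => star s).
Implicit Types (u v w r x : G) (I C : {set 'I_t}) (F D : {set {set G}}).

Definition update v (i : 'I_t) (l : 'I_s.+1) : G :=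
  [ffun j => if j == i then l else v j].

Lemma updateE v i l j : update v i l j = if j == i then l else v j.
Proof. by rewrite ffunE. Qed.

Lemma adj_update v i l :
  (v i == ord0) (+) (l == ord0) -> adj v (update v i l).
Proof.
move=> vl; apply/existsP; exists i; rewrite updateE eqxx; apply/andP; split=> //.
by apply/forallP => j; apply/implyP => /negPf ji; rewrite updateE ji.
Qed.

Lemma edges_update v i l :
  (v i == ord0) (+) (l == ord0) -> [set v; update v i l] \in edges G.
Proof. by move=> /adj_update vl; apply/imsetP; exists (v, update v i l); rewrite ?inE. Qed.

Definition agree I u v := [forall i in I, u i == v i].

Lemma agreeP I u v : reflect {in I, u =1 v} (agree I u v).
Proof.
by apply: (iffP forall_inP) => [H i /H /eqP|H i /H ->].
Qed.

(** The empty set is excluded because it would agree with every root vacuously; without it, roots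
    that differ on [C] have disjoint cones. *)
Definition cone D r C : {set {set G}} :=
  [set e in D | (e != set0) && [forall v in e, agree C r v]].

Definition reach (X : {set G}) v F :=
  [exists x in X, connect (@spanning_adj G F) v x].

Lemma spanning_connect_sub F F' u v : F \subset F' ->
  connect (@spanning_adj G F) u v -> connect (@spanning_adj G F') u v.
Proof.
move=> FF'; apply: connect_sub => {}u {}v /andP[uv uvF]; apply: connect1.
by rewrite /spanning_adj uv (subsetP FF').
Qed.

Lemma reach_increasing X v : increasing_event (reach X v).
Proof.
move=> F F' FF' /exists_inP[x xX vx]; apply/exists_inP; exists x => //.
exact: spanning_connect_sub vx.
Qed.

Variables (R : realFieldType) (p : R).
Hypotheses (p_ge0 : 0 <= p) (p_le1 : p <= 1).

(* Edges whose endpoints agree with a child of [r] on [I] are disjoint from those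
   for another child, so the children succeed independently. *)
Lemma pr_reach_branch D (X : {set G}) r C I (L : {set 'I_t * 'I_s.+1}) (q : R) :
    0 <= q <= 1 -> [disjoint C & I] ->
    (forall i l, (i, l) \in L ->
      [/\ i \in I, (r i == ord0) (+) (l == ord0),
          [set r; update r i l] \in D &
          q <= pr p (cone D (update r i l) (C :|: I))
                 (reach X (update r i l))]) ->
  1 - (1 - p * q) ^+ #|L| <= pr p (cone D r C) (reach X r).
Proof.
move=> /andP[q0 q1] disCI HL.
pose child (m : 'I_t * 'I_s.+1) := update r m.1 m.2.
pose Q m F := ([set r; child m] \in F) && reach X (child m) F.
pose Dm m := [set [set r; child m]] :|: cone D (child m) (C :|: I).
have incQ m : increasing_event (Q m).
  move=> F F' FF' /andP[eF cF]; rewrite /Q (subsetP FF') //=.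
  exact: reach_increasing cF.
have rneq m : m \in L -> child m m.1 != r m.1.
  case: m => i l /HL[_ + _ _]; rewrite updateE eqxx /=.
  by apply: contraTneq => ->; rewrite addbb.
(* A child differs from [r] in a single coordinate, which lies in [I], so its values on [I] identify
   it. *)
have agree_inj m m' : m \in L -> m' \in L ->
    {in C :|: I, child m =1 child m'} -> m = m'.
  case: m m' => [i l] [i' l'] mL m'L.
  have [iI _ _ _] := HL _ _ mL.
  move=> /(_ i); rewrite inE iI orbT !updateE eqxx => /(_ isT).
  have := rneq _ mL; rewrite updateE eqxx /=.
  by case: (i =P i') => [-> _ ->|_ /eqP].
have disr m : m \in L -> ~ {in C :|: I, child m =1 r}.
  case: m => i l mL /(_ i) cr; have [iI _ _ _] := HL _ _ mL.
  by have := rneq _ mL; rewrite /= cr ?eqxx // inE iI orbT.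
have coneP m e : e \in cone D (child m) (C :|: I) ->
    forall v, v \in e -> {in C :|: I, child m =1 v}.
  by rewrite inE => /and3P[_ _ /forall_inP ag] v /ag /agreeP.
have r_cone m e : m \in L -> e \in cone D (child m) (C :|: I) -> r \notin e.
  by move=> mL eC; apply/negP => /(coneP _ _ eC); apply: disr.
rewrite cardE.
have := pr_has p_ge0 p_le1 (r := enum L) (D := Dm) (A := Q)
  (D0 := cone D r C) (q := p * q).
move=> /(_ _ (enum_uniq _) incQ) H.
apply: le_trans (H _ _ _ _) _ => {H}.
- by rewrite mulr_ge0 ?mulr_ile1.
- case=> i l; rewrite mem_enum => mL; have [iI _ eD _] := HL _ _ mL.
  have agC : agree C r (child (i, l)).
    apply/agreeP => j jC; rewrite updateE; case: eqP => //= ji.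
    by move/pred0P: disCI => /(_ i) /=; rewrite iI -ji jC.
  rewrite subUset sub1set; apply/andP; split.
    rewrite inE eD /=; apply/andP; split.
      by apply/set0Pn; exists r; rewrite !inE eqxx.
    apply/forall_inP => v; rewrite !inE => /orP[]/eqP-> //.
    exact/agreeP.
  apply/subsetP => e; rewrite !inE => /and3P[-> -> /forall_inP ag] /=.
  apply/forall_inP => v /ag /agreeP ag_v; apply/agreeP => j jC.
  by rewrite -ag_v ?inE ?jC // (agreeP _ _ _ agC).
- case=> i l; rewrite mem_enum => mL; have [iI _ eD qle] := HL _ _ mL.
  apply: le_trans (pr_and p_ge0 p_le1 _ _ _).
  + by rewrite pr_set1 // ler_wpM2l.
  + rewrite disjoints1; apply/negP => /(r_cone _ _ mL).
    by rewrite !inE eqxx.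
  + by move=> F F' /subsetP FF' /FF'.
  + exact: reach_increasing.
- move=> m m'; rewrite !mem_enum => mL m'L mm'.
  have mNm' : {in C :|: I, child m =1 child m'} -> False.
    by move=> /(agree_inj _ _ mL m'L) eq_m; rewrite eq_m eqxx in mm'.
  apply/pred0Pn => -[e /andP[/setUP[/set1P eE|eC] /setUP[/set1P eE'|eC']]].
  + have : child m \in e by rewrite eE !inE eqxx orbT.
    rewrite eE' !inE => /orP[]/eqP E; first by apply: (disr m) => // j _; rewrite E.
    by apply: mNm' => j _; rewrite E.
  + by have := r_cone _ _ m'L eC'; rewrite eE !inE eqxx.
  + by have := r_cone _ _ mL eC; rewrite eE' !inE eqxx.
  have /set0Pn[v ve] : e != set0 by move: eC; rewrite inE => /and3P[].
  by apply: mNm' => j jCI; rewrite (coneP _ _ eC v) // (coneP _ _ eC' v).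
- apply: pr_le => // F _ /hasP[[i l]]; rewrite mem_enum => mL.
  have [_ xor eD _] := HL _ _ mL.
  move=> /andP[eF /exists_inP[x xX cx]]; apply/exists_inP; exists x => //.
  apply: connect_trans cx; apply: connect1.
  by rewrite /spanning_adj adj_update.
Qed.
End StarProduct.

(** * Numerical bounds for repeated independent trials *)

Section Estimates.
Variable R : realFieldType.

(** Since [(1 - a) ^+ m * (1 + a) ^+ m <= 1], Bernoulli's inequality bounds [(1 - a) ^+ m] by
    [1 / (1 + m a)], hence by [1 / (1 + z)]. *)
Lemma one_sub_exp_ge (a z x : R) (m : nat) :
    0 <= a <= 1 -> 0 <= z -> z <= m%:R * x -> x <= a ->
  z / (1 + z) <= 1 - (1 - a) ^+ m.
Proof.
move=> /andP[a0 a1] z0 zx xa.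
have bern : 1 + m%:R * a <= (1 + a) ^+ m.
  elim: (m) => [|n IH]; first by rewrite mul0r addr0.
  rewrite exprS -[n.+1%:R]natr1.
  have : (1 + a) * (1 + n%:R * a) <= (1 + a) * (1 + a) ^+ n.
    by rewrite ler_wpM2l // addr_ge0.
  have : 0 <= n%:R * (a * a) by rewrite !mulr_ge0.
  lra.
have z1 : 0 < 1 + z by lra.
have le1 : (1 - a) ^+ m * (1 + z) <= 1.
  apply: le_trans (_ : (1 - a) ^+ m * (1 + a) ^+ m <= 1).
    apply: ler_wpM2l; first by rewrite exprn_ge0 // subr_ge0.
    apply: le_trans bern; rewrite lerD2l (le_trans zx) //.
    by rewrite ler_wpM2l.
  rewrite -exprMn exprn_ile1 //; nra.
rewrite ler_pdivrMr // mulrBl mul1r; lra.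
Qed.

Lemma one_sub_exp_itv (x : R) (m : nat) :
  0 <= x <= 1 -> 0 <= 1 - (1 - x) ^+ m <= 1.
Proof.
move=> /andP[x0 x1]; rewrite subr_ge0 exprn_ile1 ?subr_ge0 //=; last by lra.
by rewrite lerBlDr lerDl exprn_ge0 // subr_ge0.
Qed.

(* The numerical constant comes from [q3 >= n / 4t] and [q2 >= k n / 13 t ^ 2],
   where [q3] and [q2] are the two inner probabilities. *)
Lemma branching_success_ge (p : R) (n k s t M : nat) :
    (0 < n <= t)%N -> (k <= t)%N -> (0 < M)%N ->
    (39 * t ^ 3 <= M * (s * k ^ 2))%N -> (3 * t)%:R^-1 <= p <= 1 ->
  n%:R / (n + M)%:R <=
  1 - (1 - p * (1 - (1 - p * (1 - (1 - p * 1) ^+ n)) ^+ k)) ^+ (k * s).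
Proof.
move=> /andP[n0 nt] kt M0 HM /andP[p_ge p1].
have t0 : (0 < t)%N by lia.
set T : R := t%:R; set N : R := n%:R; set K : R := k%:R.
have T0 : 0 < T by rewrite ltr0n.
have N0 : 0 < N by rewrite ltr0n.
have K0 : 0 <= K by rewrite ler0n.
have NT : N <= T by rewrite ler_nat.
have KT : K <= T by rewrite ler_nat.
have p0 : 0 <= p by apply: le_trans p_ge; rewrite invr_ge0 ler0n.
pose e : R := (3 * T)^-1.
have e0 : 0 < e by rewrite invr_gt0; lra.
have eT : e * T = 1 / 3 by rewrite /e; field; lra.
have pe : e <= p by move: p_ge; rewrite natrM.
set q3 := 1 - (1 - p * 1) ^+ n.
have q3_01 : 0 <= q3 <= 1 by apply: one_sub_exp_itv; rewrite mulr1 p0.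
have pM01 x : 0 <= x <= 1 -> 0 <= p * x <= 1.
  by move=> /andP[x0 x1]; rewrite mulr_ge0 ?mulr_ile1.
have q3_ge : N / (4 * T) <= q3.
  apply: le_trans (_ : (N * e) / (1 + N * e) <= _); last first.
    by apply: (@one_sub_exp_ge _ _ e); rewrite ?mulr1 ?p0 // mulr_ge0 ?ltW.
  rewrite ler_pdivlMr; last by nra.
  (* As [N * e <= 1 / 3], dividing by [1 + N * e] costs at most a factor 3/4; for [q2],
     [z <= 1 / 12] likewise costs at most 12/13. *)
  have -> : N / (4 * T) = 3 / 4 * (N * e) by rewrite /e; field; lra.
  have : N * e <= 1 / 3 by rewrite -eT mulrC ler_pM2l.
  have : 0 <= N * e by rewrite mulr_ge0 // ltW.
  nra.
set q2 := 1 - (1 - p * q3) ^+ k.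
have q2_01 : 0 <= q2 <= 1 by apply/one_sub_exp_itv/pM01.
have q2_ge : K * N / (13 * T ^+ 2) <= q2.
  pose z := K * (e * (N / (4 * T))).
  have NT1 : N / T <= 1 by rewrite ler_pdivrMr // mul1r.
  have KT1 : K / T <= 1 by rewrite ler_pdivrMr // mul1r.
  have NT0 : 0 <= N / T by rewrite divr_ge0 // ltW.
  have KT0 : 0 <= K / T by rewrite divr_ge0 // ltW.
  have zE : z = K / T * (N / T) / 12 by rewrite /z /e; field; lra.
  have z0 : 0 <= z by rewrite zE; nra.
  have z1 : z <= 1 / 12 by rewrite zE; nra.
  apply: le_trans (_ : z / (1 + z) <= _); last first.
    apply: (@one_sub_exp_ge _ _ (e * (N / (4 * T)))) => //; first exact: pM01.
    by apply: ler_pM => //; [exact: ltW | rewrite divr_ge0 //; lra].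
  rewrite ler_pdivlMr; last by lra.
  have -> : K * N / (13 * T ^+ 2) = 12 / 13 * z by rewrite zE; field; lra.
  nra.
have M_gt0 : 0 < M%:R :> R by rewrite ltr0n.
have -> : N / (n + M)%:R = (N / M%:R) / (1 + N / M%:R).
  rewrite natrD -/N; field; rewrite !gt_eqF //; lra.
apply: (@one_sub_exp_ge _ _ (e * (K * N / (13 * T ^+ 2)))).
- exact: pM01.
- by rewrite divr_ge0 // ltW.
- rewrite ler_pdivrMr //.
  have : (39 * t ^ 3)%:R <= (M * (s * k ^ 2))%:R :> R by rewrite ler_nat.
  rewrite !(natrX, natrM) -/T -/K => HMr.
  (* The 39 of the hypothesis is 3 * 13: [e] contributes the 3 and the bound on [q2] the 13. *)
  have -> : K * s%:R * (e * (K * N / (13 * T ^+ 2))) * M%:R =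
            N * (M%:R * (s%:R * K ^+ 2) / (39 * T ^+ 3)).
    by rewrite /e; field; lra.
  rewrite ler_peMr ?ler_pdivlMr ?mul1r //.
  by rewrite mulr_gt0 // exprn_gt0.
- apply: ler_pM => //; first exact: ltW.
  by rewrite divr_ge0 ?mulr_ge0 // ?exprn_ge0 // ltW.
Qed.

End Estimates.

(** * Descent through the levels of one copy *)

Section Levels.
Variables (s t : nat).
Let G : sgraph := box (fun _ : 'I_t => star s).
Implicit Types (u v w : G) (F D : {set {set G}}).

(* [a] only matters on [Rs], where it selects a copy. *)
Variables (Rs Sc Z : {set 'I_t}) (a : G) (k M : nat).
Hypotheses (disRS : [disjoint Rs & Sc]) (disRZ : [disjoint Rs & Z])
  (disSZ : [disjoint Sc & Z]).
Hypotheses (kt : (k <= t)%N) (M0 : (0 < M)%N)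
  (HM : (39 * t ^ 3 <= M * (s * k ^ 2))%N).
Variables (R : realFieldType) (p : R).
Hypotheses (p_ge : (3 * t)%:R^-1 <= p) (p_le1 : p <= 1).

Let p_ge0 : 0 <= p.
Proof. by apply: le_trans p_ge; rewrite invr_ge0 ler0n. Qed.

Definition level v := #|[set i in Z | v i != ord0]|.

(** Passing from [n] to [n.+1] adds the edges of the copy whose higher endpoint has level [n.+1];
    these are the fresh edges of one round of the descent. *)
Definition edges_upto n : {set {set G}} :=
  [set e in edges G | [forall v in e, agree Rs a v && (level v <= n)%N]].

(** The shape that one round of the descent restores, so that rounds can be chained. *)
Definition balanced n : {set G} :=
  [set v : G | [&& agree Rs a v, level v == n,
    #|[set i in Sc | v i == ord0]| == k & #|[set i in Sc | v i != ord0]| == k]].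

Definition hub : {set G} := [set v : G | agree Rs a v && (level v == 0%N)].

Lemma edges_upto_S n : edges_upto n \subset edges_upto n.+1.
Proof.
apply/subsetP => e; rewrite !inE => /andP[-> /forall_inP H] /=.
by apply/forall_inP => v /H /andP[-> /leqW ->].
Qed.


Lemma agree_update v i l : i \notin Rs -> agree Rs a v -> agree Rs a (update v i l).
Proof.
move=> iR /agreeP av; apply/agreeP => j jR; rewrite updateE av //.
by case: eqP => // ji; rewrite -ji jR in iR.
Qed.

Lemma level_update v i l : i \notin Z -> level (update v i l) = level v.
Proof.
move=> iZ; apply: eq_card => j; rewrite !inE updateE.
by case: (eqVneq j i) => // ->; rewrite (negPf iZ).
Qed.

Lemma level_update0 v i : i \in Z -> v i != ord0 ->
  level v = (level (update v i ord0)).+1.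
Proof.
move=> iZ vi; rewrite /level (cardsD1 i) inE iZ vi; congr _.+1.
by apply: eq_card => j; rewrite !inE updateE; case: (eqVneq j i); rewrite ?eqxx ?andbF.
Qed.

Lemma edges_level n v i l : (v i == ord0) (+) (l == ord0) ->
    agree Rs a v -> agree Rs a (update v i l) -> level v = n.+1 ->
    (level (update v i l) <= n.+1)%N ->
  [set v; update v i l] \in edges_upto n.+1 :\: edges_upto n.
Proof.
move=> vl av av' lv lv'; rewrite !inE edges_update //=; apply/andP; split.
  by apply/forall_inPn; exists v; rewrite ?inE ?eqxx // av lv ltnn.
apply/forall_inP => x; rewrite !inE => /orP[]/eqP->; first by rewrite av lv /=.
by rewrite av'.
Qed.

Lemma pr_reach_mem (D X : {set _}) v : v \in X -> pr p D (reach X v) = 1.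
Proof.
move=> vX; rewrite -[RHS](expect_cst p D); apply: expect_eq => F.
by have -> : reach X v F by apply/exists_inP; exists v.
Qed.

(** A tree exploration of depth three, branching over the disjoint coordinate sets [I1], [I2], [I3].
    Coordinates in a set already used stay frozen and label the subtrees, which keeps these
    edge-disjoint. Only the last step lowers the level, so all three edges meet level [n.+1] and are
    fresh. *)
Lemma pr_reach_balanced n w : (n < t)%N -> w \in balanced n.+1 ->
  n.+1%:R / (n.+1 + M)%:R <=
    pr p (edges_upto n.+1 :\: edges_upto n) (reach (balanced n) w).
Proof.
move=> nt wB; set D := _ :\: _.
have := wB; rewrite inE => /and4P[agw /eqP levw /eqP zw /eqP nzw].
pose I1 := [set i in Sc | w i == ord0].
pose I2 := [set i in Sc | w i != ord0].
pose I3 := [set i in Z | w i != ord0].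
apply: le_trans (branching_success_ge (n := n.+1) (k := k) (s := s) (t := t)
  (M := M) (p := p) _ _ _ _ _) _ => //; first by rewrite p_ge.
(* At the root no coordinate is frozen yet, hence the cone over [set0]. *)
apply: le_trans (_ : _ <= pr p (cone D w set0) _) _; last first.
  apply: pr_subset => //; first exact: reach_increasing.
  by apply/subsetP => e; rewrite inE => /andP[].
have inI1 i : i \in I1 -> [/\ i \in Sc, i \notin Rs, i \notin Z & w i == ord0].
  rewrite inE => /andP[iS wi]; split=> //.
    by apply/negP => iR; move/pred0P: disRS => /(_ i); rewrite /= iS iR.
  by apply/negP => iZ; move/pred0P: disSZ => /(_ i); rewrite /= iS iZ.
have inI2 i : i \in I2 -> [/\ i \in Sc, i \notin Rs, i \notin Z & w i != ord0].
  rewrite inE => /andP[iS wi]; split=> //.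
    by apply/negP => iR; move/pred0P: disRS => /(_ i); rewrite /= iS iR.
  by apply/negP => iZ; move/pred0P: disSZ => /(_ i); rewrite /= iS iZ.
have inI3 i : i \in I3 -> [/\ i \in Z, i \notin Rs, i \notin Sc & w i != ord0].
  rewrite inE => /andP[iZ wi]; split=> //.
    by apply/negP => iR; move/pred0P: disRZ => /(_ i); rewrite /= iZ iR.
  by apply/negP => iS; move/pred0P: disSZ => /(_ i); rewrite /= iZ iS.
have pM01 x : 0 <= x <= 1 -> 0 <= p * x <= 1.
  by move=> /andP[x0 x1]; rewrite mulr_ge0 ?mulr_ile1.
have q3_01 : 0 <= 1 - (1 - p * 1) ^+ n.+1 <= 1.
  by apply/one_sub_exp_itv/pM01; rewrite ler01 lexx.
set q3 := 1 - (1 - p * 1) ^+ n.+1 in q3_01 *.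
have q2_01 : 0 <= 1 - (1 - p * q3) ^+ k <= 1 by apply/one_sub_exp_itv/pM01.
set q2 := 1 - (1 - p * q3) ^+ k in q2_01 *.
have -> : (k * s)%N = #|setX I1 [set~ ord0 : 'I_s.+1]|.
  by rewrite cardsX cardsC1 card_ord zw.
apply: (pr_reach_branch p_ge0 p_le1 (I := I1)) => //.
  by rewrite -setI_eq0 set0I.
move=> j l; rewrite in_setX in_setC1 /= => /andP[jI1 l0].
have [jS jR jZ wj] := inI1 _ jI1; rewrite wj (negPf l0).
pose x1 := update w j l; rewrite -/x1.
have ag1 : agree Rs a x1 by apply: agree_update.
have lev1 : level x1 = n.+1 by rewrite level_update.
split=> //.
  by apply: edges_level => //; rewrite ?wj ?(negPf l0) // -/x1 lev1.
rewrite /q2 (_ : k = #|setX I2 [set ord0 : 'I_s.+1]|); last first.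
  by rewrite cardsX cards1 muln1.
apply: (pr_reach_branch p_ge0 p_le1 (I := I2)) => //.
  rewrite set0U -setI_eq0; apply/eqP/setP => i; rewrite !inE.
  by case: (w i == ord0); rewrite ?andbF.
move=> i l'; rewrite in_setX in_set1 /= => /andP[iI2 /eqP->{l'}].
have [iS iR iZ wi] := inI2 _ iI2.
have ij : i != j by apply: contraNneq wi => ->.
have x1i : x1 i != ord0 by rewrite updateE (negPf ij).
rewrite eqxx (negPf x1i).
pose x2 := update x1 i ord0; rewrite -/x2.
have ag2 : agree Rs a x2 by apply: agree_update.
have lev2 : level x2 = n.+1 by rewrite level_update.
split=> //.
  by apply: edges_level => //; rewrite ?eqxx ?(negPf x1i) // -/x2 lev2.
(* The third step has [level w] choices, and its inner probability is 1 because its endpoint already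
   lies in the target. *)
rewrite /q3 -levw (_ : level w = #|setX I3 [set ord0 : 'I_s.+1]|); last first.
  by rewrite cardsX cards1 muln1.
apply: (pr_reach_branch p_ge0 p_le1 (I := I3)) => //.
- by rewrite ler01 lexx.
- rewrite set0U -setI_eq0; apply/eqP/setP => x; rewrite !inE.
  apply/negP => /andP[+ xI3]; have xI3' : x \in I3 by rewrite inE.
  by have [_ _ /negPf-> _] := inI3 x xI3'.
move=> x l'; rewrite in_setX in_set1 /= => /andP[xI3 /eqP->{l'}].
have [xZ xR xS wx] := inI3 _ xI3.
have xj : x != j by apply: contraNneq wx => ->.
have xi : x != i by apply: contraNneq xS => ->.
have x2x : x2 x != ord0 by rewrite !updateE (negPf xi) (negPf xj).
rewrite eqxx (negPf x2x).
pose x3 := update x2 x ord0; rewrite -/x3.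
have ag3 : agree Rs a x3 by apply: agree_update.
have lev3 : level x3 = n.
  by apply/succn_inj; rewrite -lev2 (level_update0 xZ x2x).
split=> //.
  by apply: edges_level => //; rewrite ?eqxx ?(negPf x2x) // -/x3 lev3.
(* The centre [j] has become a leaf and the leaf [i] a centre, so both counts on [Sc] are [k]
   again. *)
rewrite pr_reach_mem // inE ag3 lev3 eqxx /=; apply/andP; split.
  have -> : [set y in Sc | x3 y == ord0] = i |: I1 :\ j.
    apply/setP => y; rewrite !inE !updateE.
    case: (eqVneq y x) => [->|yx]; first by rewrite (negPf xS) !andbF (negPf xi).
    case: (eqVneq y i) => [->|yi]; first by rewrite iS.
    by case: (eqVneq y j) => [->|yj] //=; rewrite (negPf l0) andbF.
  rewrite cardsU1 !inE (negPf wi) !andbF /= add1n.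
  by rewrite -zw -/I1 (cardsD1 j I1) jI1.
have -> : [set y in Sc | x3 y != ord0] = j |: I2 :\ i.
  apply/setP => y; rewrite !inE !updateE.
  case: (eqVneq y x) => [->|yx]; first by rewrite (negPf xS) !andbF (negPf xj).
  case: (eqVneq y i) => [->|yi]; first by rewrite andbF (negPf ij).
  by case: (eqVneq y j) => [->|yj] //=; rewrite l0 andbT jS.
rewrite cardsU1 !inE wj !andbF /= add1n.
by rewrite -nzw -/I2 (cardsD1 i I2) iI2.
Qed.

(** The factors [m / (m + M)] for [m] from 1 to [n] multiply to the inverse binomial coefficient.
    The top layer is revealed first; the descent then continues from the vertex reached, through
    lower layers that are still unrevealed. *)
Lemma pr_reach_hub n w : (n <= t)%N -> w \in balanced n ->
  'C(n + M, M)%:R^-1 <= pr p (edges_upto n) (reach hub w).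
Proof.
elim: n w => [|n IH] w nt wB.
  rewrite add0n binn invr1 pr_reach_mem //.
  by move: wB; rewrite !inE => /and4P[-> -> _ _].
rewrite -(setID (edges_upto n.+1) (edges_upto n)) (setIidPr (edges_upto_S n)).
apply: le_trans (_ : 'C(n + M, M)%:R^-1 * (n.+1%:R / (n.+1 + M)%:R) <= _).
  rewrite -[X in _ <= _ * X]invf_div -invfM lef_pV2 ?posrE; last 2 first.
  - by rewrite ltr0n bin_gt0 leq_addl.
  - by rewrite mulr_gt0 ?divr_gt0 ?ltr0n ?bin_gt0 ?leq_addl // addSn.
  rewrite mulrA ler_pdivrMr ?ltr0n // -!natrM ler_nat.
  by have := mul_bin_down (n.+1 + M) M; rewrite addnK addSn /= [(_ * n.+1)%N]mulnC => <-; rewrite mulnC.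
apply: le_trans (_ : _ <= 'C(n + M, M)%:R^-1 *
  pr p (edges_upto n.+1 :\: edges_upto n) (reach (balanced n) w)) _.
  by rewrite ler_wpM2l ?invr_ge0 ?ler0n // pr_reach_balanced.
apply: pr_setU_ge => // [|F2 _ /exists_inP[v vB wv]].
  by rewrite disjoint_sym disjoints_subset setDE subsetIr.
apply: le_trans (IH v (ltnW nt) vB) _; apply: pr_le => // F1 _.
case/exists_inP => x xH vx; apply/exists_inP; exists x => //.
apply: (connect_trans (y := v)).
  exact: spanning_connect_sub (subsetUr _ _) wv.
exact: spanning_connect_sub (subsetUl _ _) vx.
Qed.

End Levels.

Lemma card_ord_interval (t m n : nat) : (n <= t)%N ->
  #|[set i : 'I_t | m <= i < n]%N| = (n - m)%N.
Proof.
move=> nt; rewrite -sum1_card.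
under eq_bigl do rewrite inE andbC.
rewrite -(big_geq_mkord m t (fun i => (i < n)%N) (fun=> 1%N)).
by rewrite -(big_nat_widen _ _ _ xpredT) // sum_nat_const_nat muln1.
Qed.

Lemma leq_component_order (G : sgraph) (v : G) : (#|component v| <= largest_component_order G)%N.
Proof. exact: (leq_bigmax (F := fun v : G => #|component v|)). Qed.

(** * Monotonicity and counting for the largest component *)

Section LargestComponent.
Variables (G : sgraph).
Implicit Types (F : {set {set G}}) (H W : {set G}).

Lemma largest_component_order_increasing F F' : F \subset F' ->
  (largest_component_order (spanning F) <= largest_component_order (spanning F'))%N.
Proof.
move=> FF'; apply/bigmax_leqP => v _.
apply: leq_trans (@leq_component_order (spanning F') v).
apply/subset_leq_card/subsetP => w; rewrite !inE.
apply: connect_sub => {}v {}w /andP[vw vwF]; apply: connect1.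
by rewrite /= /spanning_adj vw (subsetP FF').
Qed.

(** The components of the points of [H] cover [W]; the proof counts pairs [(h, w)]. *)
Lemma card_reach_le F H W :
    (forall w, w \in W -> exists2 h, h \in H & connect (@spanning_adj G F) w h) ->
  (#|W| <= #|H| * largest_component_order (spanning F))%N.
Proof.
move=> WH; rewrite -sum_nat_const.
apply: leq_trans (_ : \sum_(h in H) #|@component (spanning F) h| <= _)%N; last first.
  by apply: leq_sum => h _; apply: leq_component_order.
have -> : (\sum_(h in H) #|@component (spanning F) h| =
    \sum_(w : G) \sum_(h in H) (w \in @component (spanning F) h))%N.
  by rewrite exchange_big; apply: eq_bigr => h _; rewrite -sum1_card big_mkcond.
rewrite -sum1_card big_mkcond; apply: leq_sum => w _; case: ifP => // wW.
have [h hH wh] := WH w wW.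
rewrite (bigD1 h) //= inE (_ : connect _ h w) //.
by rewrite (sym_connect_sym (@spanning_sym G F)).
Qed.

End LargestComponent.

Lemma card_box_family (s t : nat) (P : 'I_t -> {set 'I_s.+1}) :
  #|[set v : box (fun _ : 'I_t => star s) | [forall i, v i \in P i]]| =
  (\prod_i #|P i|)%N.
Proof.
rewrite cardsE; transitivity #|family (fun i : 'I_t => mem (P i) : pred (star s))|.
  by apply: eq_card => v; apply/forallP/familyP.
by rewrite card_family foldrE big_map big_enum.
Qed.

(** * A large component inside one copy *)

Section OneCopy.
Variables (s t : nat).
Let G : sgraph := box (fun _ : 'I_t => star s).

Variables (Rs Sc Z : {set 'I_t}) (k M : nat).
Hypotheses (disRS : [disjoint Rs & Sc]) (disRZ : [disjoint Rs & Z])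
  (disSZ : [disjoint Sc & Z]) (cover : Rs :|: Sc :|: Z = [set: 'I_t]).
Hypotheses (s0 : (0 < s)%N) (kt : (k <= t)%N) (M0 : (0 < M)%N)
  (HM : (39 * t ^ 3 <= M * (s * k ^ 2))%N).
Variables (R : realFieldType) (p : R).
Hypotheses (p_ge : (3 * t)%:R^-1 <= p) (p_le1 : p <= 1).

Let p_ge0 : 0 <= p.
Proof. by apply: le_trans p_ge; rewrite invr_ge0 ler0n. Qed.

(** A hub vertex is prescribed by [a] on [Rs] and is a centre on [Z], so only the coordinates in
    [Sc] are free. *)
Lemma card_hub (a : G) : (#|hub Rs Z a| <= s.+1 ^ #|Sc|)%N.
Proof.
pose P i : {set 'I_s.+1} :=
  if i \in Sc then setT else if i \in Rs then [set a i] else [set ord0].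
apply: leq_trans (_ : #|[set v : G | [forall i, v i \in P i]]| <= _)%N.
  apply/subset_leq_card/subsetP => v; rewrite !inE => /andP[/agreeP av lv].
  apply/forallP => i; rewrite /P; case: ifP => // iS.
  case: ifP => iR; first by rewrite av // inE.
  rewrite inE; apply: contraTT lv => vi; rewrite -lt0n.
  apply/card_gt0P; exists i; rewrite inE vi andbT.
  by have := in_setT i; rewrite -cover !inE iR iS.
rewrite card_box_family -prod_nat_const [leqRHS]big_mkcond /=; apply: leq_prod => i _.
by rewrite /P; case: (i \in Sc); rewrite ?cardsT ?card_ord //; case: ifP; rewrite cards1.
Qed.

Lemma pr_large_component_copy (a : G) (y : R) :
    #|[set i in Sc | a i == ord0]| = k -> #|[set i in Sc | a i != ord0]| = k ->
    (2 * 'C(#|Z| + M, M) * s.+1 ^ #|Sc|)%:R * y <= (s ^ #|Z|)%:R ->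
  (2 * 'C(#|Z| + M, M))%:R^-1 <=
    pr p (edges_upto Rs Z a #|Z|)
      (fun F => y <= (largest_component_order (@spanning G F))%:R).
Proof.
move=> za nza ybound.
set rho : R := 'C(#|Z| + M, M)%:R; set A := (fun F => y <= _).
pose P i : {set 'I_s.+1} := if i \in Z then [set~ ord0] else [set a i].
pose W := [set v : G | [forall i, v i \in P i]].
have cardW : #|W| = (s ^ #|Z|)%N.
  rewrite card_box_family -prod_nat_const [RHS]big_mkcond /=.
  by apply: eq_bigr => i _; rewrite /P; case: ifP; rewrite ?cardsC1 ?card_ord ?cards1.
have W0 : 0 < #|W|%:R :> R by rewrite cardW ltr0n expn_gt0 s0.
have rho0 : 0 < rho by rewrite ltr0n bin_gt0 leq_addl.
have Wbal w : w \in W -> w \in balanced Rs Sc Z a k #|Z|.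
  rewrite !inE => /forallP wP.
  have wZ i : i \in Z -> w i != ord0 by move=> iZ; have := wP i; rewrite /P iZ !inE.
  have wa i : i \notin Z -> w i = a i.
    by move=> iZ; have := wP i; rewrite /P (negPf iZ) inE => /eqP.
  have waS i : i \in Sc -> w i = a i.
    move=> iS; apply: wa; apply/negP => iZ.
    by move/pred0P: disSZ => /(_ i); rewrite /= iS iZ.
  apply/and4P; split.
  - apply/agreeP => i iR; rewrite wa //; apply/negP => iZ.
    by move/pred0P: disRZ => /(_ i); rewrite /= iR iZ.
  - apply/eqP/eq_card => i; rewrite !inE.
    by case: (boolP (i \in Z)) => // /wZ ->.
  - rewrite -[X in _ == X]za; apply/eqP/eq_card => i; rewrite !inE.
    by case: (boolP (i \in Sc)) => // /waS ->.
  - rewrite -[X in _ == X]nza; apply/eqP/eq_card => i; rewrite !inE.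
    by case: (boolP (i \in Sc)) => // /waS ->.
pose D := edges_upto Rs Z a #|Z|.
(* Reverse Markov inequality for the number of
   vertices of [W] joined to the hub. *)
have lower : #|W|%:R / rho <=
    expect p D (fun F => \sum_(w in W) (reach (hub Rs Z a) w F)%:R).
  rewrite expect_sum mulr_natl -sumr_const; apply: ler_sum => w wW.
  apply: (pr_reach_hub disRS disRZ disSZ kt M0 HM) => //; last exact: Wbal.
  by rewrite -[leqRHS]card_ord max_card.
(* If [A] fails, at most [#|hub Rs Z a| * y] vertices are joined, which by [ybound] is at most half
   of the lower bound [#|W| / rho]; if [A] holds, the trivial bound [#|W|] is used. *)
have upper : expect p D (fun F => \sum_(w in W) (reach (hub Rs Z a) w F)%:R) <=
    #|W|%:R * pr p D A + #|W|%:R / (2 * rho).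
  rewrite -expectZ -[X in _ + X](expect_cst p D) -expectD.
  apply: expect_le => // F _; rewrite -natr_sum.
  have -> : (\sum_(w in W) reach (hub Rs Z a) w F)%N =
      #|[set w in W | reach (hub Rs Z a) w F]|.
    rewrite -sum1_card; under [RHS]eq_bigl do rewrite inE.
    by rewrite [RHS]big_mkcondr; apply: eq_bigr => w _; case: (reach _ _ _).
  rewrite /A; case: (leP y (largest_component_order (@spanning G F))%:R) => [_|ylt].
    rewrite mulr1 -[leLHS]addr0 lerD //; last by rewrite divr_ge0 ?mulr_ge0 // ltW.
    by rewrite ler_nat; apply/subset_leq_card/subsetP => w; rewrite inE => /andP[].
  rewrite mulr0 add0r ler_pdivlMr ?mulr_gt0 //.
  set X := [set w in W | _].
  have XH : (#|X| <= #|hub Rs Z a| * largest_component_order (@spanning G F))%N.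
    by apply: card_reach_le => w; rewrite inE => /andP[_ /exists_inP].
  rewrite cardW; apply: le_trans ybound.
  rewrite mulrC [leRHS]mulrC natrM -/rho natrM -/rho.
  have y0 : 0 <= y by rewrite (le_trans _ (ltW ylt)).
  apply: le_trans (_ : 2 * rho * (s.+1 ^ #|Sc|)%:R * y <= _); last by lra.
  rewrite -mulrA ler_pM2l ?mulr_gt0 //.
  apply: le_trans (_ : (#|hub Rs Z a| * largest_component_order (@spanning G F))%:R <= _).
    by rewrite ler_nat.
  by rewrite natrM ler_pM ?ler0n ?ler_nat ?card_hub // ltW.
rewrite natrM invfM -/rho.
have := le_trans lower upper.
rewrite -[leLHS]/(#|W|%:R * rho^-1) -mulrDr ler_pM2l // [(2 * rho)^-1]invfM.
lra.
Qed.

End OneCopy.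

(** * Combining the edge-disjoint copies *)

Lemma card_star_box (s t : nat) :
  #|box (fun _ : 'I_t => star s)| = (s.+1 ^ t)%N.
Proof.
have := card_box_family (t := t) (fun=> [set: 'I_s.+1]).
rewrite prod_nat_const cardsT !card_ord => <-.
by rewrite -cardsT; apply: eq_card => v; rewrite !inE; apply/esym/forallP => i; rewrite inE.
Qed.

Lemma percolation_probE (R : realType) (G : sgraph) (p : R) (A : pred sgraph) :
  percolation_prob G p A = pr p (edges G) (fun F => A (spanning F)).
Proof.
rewrite /percolation_prob big_mkcondr; apply: eq_bigr => F _.
by case: ifP => _; rewrite ?mulr1 ?mulr0.
Qed.

(** The values on [Rs] index [s.+1 ^ k] edge-disjoint copies. Each succeeds with probability at
    least [(2 * C)%:R^-1], and one success is enough. *)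
Lemma percolation_prob_ge (R : realType) (s t k M : nat) (p y : R) :
    let G := box (fun _ : 'I_t => star s) in
    let C := 'C(t - 3 * k + M, M) in
    (0 < s)%N -> (3 * k <= t)%N -> (0 < M)%N ->
    (39 * t ^ 3 <= M * (s * k ^ 2))%N -> (3 * t)%:R^-1 <= p -> p <= 1 ->
    (2 * C * s.+1 ^ (2 * k))%:R * y <= (s ^ (t - 3 * k))%:R ->
  1 - (1 - (2 * C)%:R^-1) ^+ (s.+1 ^ k) <=
    percolation_prob G p (fun H => y <= (largest_component_order H)%:R).
Proof.
move=> G C s0 k3t M0 HM p_ge p_le1 ybound.
have p_ge0 : 0 <= p by apply: le_trans p_ge; rewrite invr_ge0 ler0n.
rewrite percolation_probE.
set Big := (fun F : {set {set G}} => _).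
pose Rs := [set i : 'I_t | i < k]%N.
pose Sc := [set i : 'I_t | k <= i < 3 * k]%N.
pose Z := [set i : 'I_t | 3 * k <= i < t]%N.
have disRS : [disjoint Rs & Sc].
  by apply/pred0P => i; rewrite /= !inE; apply/negP; lia.
have disRZ : [disjoint Rs & Z].
  by apply/pred0P => i; rewrite /= !inE; apply/negP; lia.
have disSZ : [disjoint Sc & Z].
  by apply/pred0P => i; rewrite /= !inE; apply/negP; lia.
have cover : Rs :|: Sc :|: Z = [set: 'I_t].
  by apply/setP => i; rewrite !inE ltn_ord; lia.
have cardRs : #|Rs| = k.
  by rewrite -[RHS]subn0 -(@card_ord_interval t) //; lia.
have cardSc : #|Sc| = (2 * k)%N by rewrite card_ord_interval //; lia.
have cardZ : #|Z| = (t - 3 * k)%N by rewrite card_ord_interval.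
(* One pattern off [Rs] for all representatives: on [Sc] it has [k] centres followed by [k] leaves,
   [ord_max] being a leaf because [0 < s]. *)
pose pat (i : 'I_t) : 'I_s.+1 := if (i < 2 * k)%N then ord0 else ord_max.
pose P i : {set 'I_s.+1} := if i \in Rs then setT else [set pat i].
pose As := [set b : G | [forall i, b i \in P i]].
have AsP b : b \in As -> forall i, i \notin Rs -> b i = pat i.
  rewrite inE => /forallP bP i iR; have := bP i.
  by rewrite /P (negPf iR) inE => /eqP.
have cardAs : #|As| = (s.+1 ^ k)%N.
  rewrite card_box_family -cardRs -prod_nat_const [RHS]big_mkcond /=.
  by apply: eq_bigr => i _; rewrite /P; case: ifP; rewrite ?cardsT ?card_ord ?cards1.
have ScRs i : i \in Sc -> i \notin Rs by rewrite !inE; lia.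
have zeros b : b \in As -> #|[set i in Sc | b i == ord0]| = k.
  move=> bA; transitivity #|[set i : 'I_t | k <= i < 2 * k]%N|; last first.
    by rewrite card_ord_interval; lia.
  apply: eq_card => i; rewrite in_set [RHS]in_set.
  case: (boolP (i \in Sc)) => [iS|]; last by rewrite inE; lia.
  rewrite (AsP _ bA) ?ScRs // /pat; move: iS; rewrite inE.
  by case: (ltnP i (2 * k)) => ik iS; rewrite -?val_eqE /= ?eqxx; lia.
have nonzeros b : b \in As -> #|[set i in Sc | b i != ord0]| = k.
  move=> bA; transitivity #|[set i : 'I_t | 2 * k <= i < 3 * k]%N|; last first.
    by rewrite card_ord_interval; lia.
  apply: eq_card => i; rewrite in_set [RHS]in_set.
  case: (boolP (i \in Sc)) => [iS|]; last by rewrite inE; lia.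
  rewrite (AsP _ bA) ?ScRs // /pat; move: iS; rewrite inE.
  by case: (ltnP i (2 * k)) => ik iS; rewrite -?val_eqE /= ?eqxx; lia.
have incBig : increasing_event Big.
  move=> F F' FF' /le_trans; apply; rewrite ler_nat.
  exact: largest_component_order_increasing.
have := pr_has p_ge0 p_le1 (r := enum As) (D := fun b => edges_upto Rs Z b #|Z|)
  (A := fun=> Big) (D0 := edges G) (q := (2 * C)%:R^-1).
rewrite -cardE cardAs => has_ge; apply: le_trans (has_ge _ _ _ _ _ _) _ => {has_ge}.
- rewrite invr_ge0 ler0n invf_le1 ?ler1n ?ltr0n ?muln_gt0 ?bin_gt0 ?leq_addl //.
- exact: enum_uniq.
- by [].
- by move=> b _; apply/subsetP => e; rewrite inE => /andP[].
- move=> b; rewrite mem_enum => bA; rewrite /C -cardZ.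
  apply: (pr_large_component_copy disRS disRZ disSZ cover s0 _ M0 HM);
    rewrite ?zeros ?nonzeros ?cardZ ?cardSc //; lia.
(* An endpoint of a common edge agrees with both representatives on [Rs]; off [Rs] they share the
   pattern. *)
- move=> b b'; rewrite !mem_enum => bA b'A; apply: contraNT => /pred0Pn[e /andP[]].
  rewrite !inE => /andP[/imsetP[[u v] _ eE] /forall_inP H] /andP[_ /forall_inP H'].
  have ue : u \in e by rewrite eE !inE eqxx.
  have /andP[/agreeP bu _] := H _ ue; have /andP[/agreeP b'u _] := H' _ ue.
  apply/eqP/ffunP => i; have [iR|iR] := boolP (i \in Rs); first by rewrite bu ?b'u.
  by rewrite !AsP.
- by apply: pr_le => // F _ /hasP[].
Qed.

(** * Asymptotics *)

From mathcomp Require Import all_classical all_reals all_analysis.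

Import numFieldNormedType.Exports.

Local Open Scope classical_set_scope.
Local Open Scope ring_scope.

(** The left side is one term of the binomial expansion of [(s + 1) ^ (n + m)]. So the coefficient
    is at most [(s + 1) ^ m * (1 + 1 / s) ^ n]. *)
Lemma bin_mul_exp_le (n m s : nat) :
  ('C(n + m, m) * s ^ n <= s.+1 ^ (n + m))%N.
Proof.
have mnm : (m < (n + m).+1)%N by rewrite ltnS leq_addl.
rewrite -[s.+1]addn1 expnDn (bigD1 (Ordinal mnm)) //= exp1n muln1 addnK.
exact: leq_addr.
Qed.

Section Asymptotics.
Variables (R : realType) (s t d k M : nat) (delta : R).
Hypotheses (delta_gt0 : 0 < delta) (delta_le : delta <= 1 / 1000)
  (s_delta : s%:R * delta ^+ 6 = 1)
  (d_ge : 20 <= d%:R * delta) (d_le : d%:R * delta <= 21)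
  (t_ge : 200 <= t%:R * delta)
  (kE : k = (t %/ d)%N) (ME : M = ((156 * d ^ 2 * t) %/ s).+1).

Let bounds : [/\ 0 < delta, delta <= 1 / 1000, 20 <= d%:R * delta,
  d%:R * delta <= 21 & 200 <= t%:R * delta].
Proof. by []. Qed.

Let d_gt0 : (0 < d)%N.
Proof. by rewrite lt0n; apply: contraTneq d_ge => ->; rewrite mul0r -ltNge. Qed.

Let s_gt0 : (0 < s)%N.
Proof. by rewrite lt0n; apply: contra_eqN s_delta => /eqP->; rewrite mul0r eq_sym oner_eq0. Qed.

Let d_le_t : (d <= t)%N.
Proof.
rewrite -(ler_nat R) -(ler_pM2r delta_gt0); apply: le_trans d_le _; by apply: le_trans t_ge; rewrite ler_nat.
Qed.

Lemma scratch_blocks_fit : (3 * k <= t)%N.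
Proof.
have [dl0 dl dg dl21 tg] := bounds.
have d3 : (3 <= d)%N.
  rewrite -(ler_nat R); apply: contraTT d_ge; rewrite -!ltNge => d3.
  have : d%:R * delta <= 3 * (1 / 1000) by apply: ler_pM => //; lra.
  lra.
rewrite kE mulnC; apply: leq_trans (leq_divM t d).
by rewrite leq_mul2l d3 orbT.
Qed.

(** From [t < (k + 1) d <= 2 d k] follows [39 t ^ 3 <= 39 t (2 d k) ^ 2 = 156 d ^ 2 t k ^ 2], whence
    the 156 in [M]. *)
Lemma detour_parameter_ge : (39 * t ^ 3 <= M * (s * k ^ 2))%N.
Proof.
have k1 : (1 <= k)%N by rewrite kE divn_gt0 ?d_le_t.
have tk : (t <= 2 * (d * k))%N.
  have : (t < k.+1 * d)%N by rewrite kE -ltn_divLR.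
  have : (d <= d * k)%N by rewrite leq_pmulr.
  by rewrite mulSn; lia.
have Ms : (156 * d ^ 2 * t <= M * s)%N by rewrite ME ltnW // -ltn_divLR.
apply: leq_trans (_ : 156 * d ^ 2 * t * k ^ 2 <= _)%N; last first.
  by rewrite mulnA leq_mul2r Ms orbT.
have -> : (156 * d ^ 2 * t * k ^ 2 = 39 * t * (2 * (d * k)) ^ 2)%N.
  by rewrite !expnMn; lia.
by rewrite expnS mulnA leq_mul2l leq_exp2r // tk orbT.
Qed.

Let k_le : k%:R <= t%:R * delta / 20 :> R.
Proof.
have [dl0 dl dg dl21 tg] := bounds.
have kd : k%:R * d%:R <= t%:R :> R by rewrite -natrM ler_nat kE leq_divM.
have : k%:R * (d%:R * delta) <= t%:R * delta by rewrite mulrA ler_pM2r.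
have : k%:R * 20 <= k%:R * (d%:R * delta) by rewrite ler_wpM2l.
lra.
Qed.

Let k_ge : t%:R * delta / 42 <= k%:R :> R.
Proof.
have [dl0 dl dg dl21 tg] := bounds.
have k1 : 1 <= k%:R :> R by rewrite ler1n kE divn_gt0 ?d_le_t.
have kd : t%:R <= (k%:R + 1) * d%:R :> R.
  rewrite natr1 -natrM ler_nat ltnW //.
  by have := ltn_divLR t (k.+1) d_gt0; rewrite -kE ltnSn => <-.
have : t%:R * delta <= (k%:R + 1) * (d%:R * delta) by rewrite mulrA ler_pM2r.
have : (k%:R + 1) * (d%:R * delta) <= (2 * k%:R) * 21 by apply: ler_pM => //; lra.
lra.
Qed.

Let sV : s%:R^-1 = delta ^+ 6.
Proof. by apply: (mulfI (x := s%:R)); rewrite ?s_delta ?mulfV // pnatr_eq0 -lt0n. Qed.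

Let delta_pow2_le : delta ^+ 2 <= delta / 1000.
Proof.
have [dl0 dl dg dl21 tg] := bounds.
by rewrite expr2 ler_pM2l // -div1r.
Qed.

Let delta_pow4_le : delta ^+ 4 <= delta / 1000 / 1000 / 1000.
Proof.
have [dl0 dl dg dl21 tg] := bounds; have d2 := delta_pow2_le.
have d20 : 0 <= delta ^+ 2 by rewrite exprn_ge0 // ltW.
have -> : delta ^+ 4 = delta ^+ 2 * delta ^+ 2 by ring.
have : delta ^+ 2 * delta ^+ 2 <= delta / 1000 * (delta / 1000).
  exact: ler_pM.
rewrite expr2 in d2; lra.
Qed.

Let delta_pow6_le : delta ^+ 6 <= delta / 1000.
Proof.
have [dl0 dl dg dl21 tg] := bounds; have d2 := delta_pow2_le.
apply: le_trans d2; rewrite ler_iXn2l //; lra.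
Qed.

(** As [1 / s = delta ^+ 6] and [d * delta <= 21], the quotient in [M] is at most
    [156 * 21 ^ 2 * t * delta ^+ 4], and [delta ^+ 3 <= 10 ^ -9] absorbs the constant. *)
Let M_le : M%:R <= t%:R * delta / 1000 + 1 :> R.
Proof.
have [dl0 dl dg dl21 tg] := bounds.
rewrite ME -natr1 lerD2r.
apply: le_trans (_ : (156 * d ^ 2 * t)%:R / s%:R <= _).
  by rewrite ler_pdivlMr ?ltr0n // -natrM ler_nat leq_divM.
rewrite sV !(natrX, natrM).
have -> : 156 * d%:R ^+ 2 * t%:R * delta ^+ 6 =
    156 * ((d%:R * delta) ^+ 2 * (t%:R * delta ^+ 4)) by ring.
have X0 : 0 <= (d%:R * delta) ^+ 2 by apply: sqr_ge0.
have X1 : (d%:R * delta) ^+ 2 <= 21 * 21 by rewrite expr2; apply: ler_pM => //; lra.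
have Y0 : 0 <= t%:R * delta ^+ 4 by rewrite mulr_ge0 // exprn_ge0 // ltW.
have Y1 : t%:R * delta ^+ 4 <= t%:R * (delta / 1000 / 1000 / 1000).
  exact: ler_wpM2l delta_pow4_le.
have := ler_pM X0 Y0 X1 Y1; lra.
Qed.

Let t_div_s_le : t%:R / s%:R <= t%:R * delta / 1000 :> R.
Proof.
rewrite sV -mulrA; apply: ler_wpM2l delta_pow6_le; exact: ler0n.
Qed.

Let b : R := ln s.+1%:R.

Let b_ge : 1 / 2 <= b.
Proof.
have [dl0 dl dg dl21 tg] := bounds.
set x : R := s.+1%:R^-1.
have bE : b = - ln x by rewrite lnV ?posrE ?ltr0n // opprK.
have x_le : x <= 1 / 2 by rewrite mul1r lef_pV2 ?posrE ?ltr0n // ler_nat.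
have x0 : 0 < x by rewrite invr_gt0 ltr0n.
have : ln x <= x - 1 by rewrite -{1}[x](subrK 1) addrC le_ln1Dx //; lra.
lra.
Qed.

(** Replacing [s + 1] by [s] costs [ln (1 + 1 / s) <= 1 / s <= 2 b / s], the last step by [b_ge]. *)
Let ln_s_ge : b * (1 - 2 / s%:R) <= ln s%:R.
Proof.
have [dl0 dl dg dl21 tg] := bounds.
have s0 : 0 < s%:R :> R by rewrite ltr0n.
have : b = ln s%:R + ln (1 + s%:R^-1).
  have s1 : 0 < 1 + s%:R^-1 :> R by rewrite addr_gt0 ?invr_gt0.
  by rewrite -lnM ?posrE // mulrDr mulfV ?mulr1 ?gt_eqF // natr1.
have : ln (1 + s%:R^-1) <= s%:R^-1 :> R.
  by rewrite le_ln1Dx // (lt_trans (ltrN10 _)) // invr_gt0.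
have : 0 <= (b - 1 / 2) * s%:R^-1 by rewrite mulr_ge0 ?subr_ge0 // invr_ge0 ltW.
lra.
Qed.

Let expb n : s.+1%:R ^+ n = expR (n%:R * b).
Proof. by rewrite mulrC expRM_natr lnK // posrE ltr0n. Qed.

Let exps n : expR (n%:R * (b * (1 - 2 / s%:R))) <= s%:R ^+ n.
Proof.
have s0 : 0 < s%:R :> R by rewrite ltr0n.
apply: le_trans (_ : expR (n%:R * ln s%:R) <= _).
  by rewrite ler_expR ler_wpM2l.
by rewrite mulrC expRM_natr lnK // posrE.
Qed.

Let Z := (t - 3 * k)%N.

Let ZE : Z%:R = t%:R - 3 * k%:R :> R.
Proof. by rewrite natrB ?scratch_blocks_fit // natrM. Qed.

Let two_le : 2 <= expR b.
Proof. by rewrite lnK ?posrE ?ltr0n // ler_nat. Qed.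

Let C := 'C(Z + M, M).

Let C_le : C%:R * s%:R ^+ Z <= expR ((Z + M)%:R * b).
Proof. by rewrite -expb -!natrX -natrM ler_nat bin_mul_exp_le. Qed.

(** Multiplying by [s ^ Z] turns [C] into a power of [s.+1]. Comparing exponents to base [s.+1], it
    remains that [1 + 5 k + M + 4 t / s <= t delta + 12 k / s], where [5 k] takes only a quarter of
    [t delta]. *)
Lemma component_threshold_le :
  (2 * C * s.+1 ^ (2 * k))%:R * ((s.+1 ^ t)%:R `^ (1 - delta)) <= (s ^ Z)%:R :> R.
Proof.
have [dl0 dl dg dl21 tg] := bounds.
have y_eq : (s.+1 ^ t)%:R `^ (1 - delta) = expR (t%:R * (1 - delta) * b).
  rewrite natrX expb /powR gt_eqF ?expR_gt0 // expRK; congr expR; ring.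
have sZ0 : 0 < s%:R ^+ Z :> R by rewrite exprn_gt0 // ltr0n.
rewrite y_eq natrM natrX expb [(2 * C)%:R]natrM natrX -(ler_pM2r sZ0).
apply: le_trans (_ : expR b * expR ((Z + M)%:R * b) *
   expR ((2 * k)%:R * b) * expR (t%:R * (1 - delta) * b) <= _).
  have -> : 2 * C%:R * expR ((2 * k)%:R * b) *
     expR (t%:R * (1 - delta) * b) * s%:R ^+ Z = 2 * (C%:R * s%:R ^+ Z) *
     expR ((2 * k)%:R * b) * expR (t%:R * (1 - delta) * b) by ring.
  do 2![rewrite ler_pM2r ?expR_gt0 //].
  by apply: ler_pM => //; rewrite mulr_ge0 // ltW.
rewrite -!expRD -expr2 -exprM.
apply: le_trans (exps _); rewrite ler_expR.
rewrite natrD !natrM ZE.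
have := k_le; have := M_le; have := t_div_s_le.
set T := t%:R * delta => h1 h2 h3.
set rs := s%:R^-1.
have rs0 : 0 <= rs by rewrite invr_ge0.
have tr : t%:R * rs <= T / 1000 by [].
have kr : 0 <= k%:R * rs by rewrite mulr_ge0.
have -> : b + (t%:R - 3 * k%:R + M%:R) * b + 2 * k%:R * b + t%:R * (1 - delta) * b =
  b * (1 + 2 * t%:R - k%:R + M%:R - T) by rewrite /T; ring.
have -> : (t%:R - 3 * k%:R) * 2 * (b * (1 - 2 * rs)) =
  b * (2 * t%:R - 6 * k%:R - 4 * (t%:R * rs) + 12 * (k%:R * rs)) by ring.
rewrite ler_pM2l; last by have := b_ge; lra.
by have := t_ge; rewrite -/T; lra.
Qed.

(** The number of copies must exceed [2 * C] by the factor [z]. After multiplying by [s ^ Z],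
    exponents reduce this to [T / 50 - 1 + M + 2 t / s <= k + 6 k / s], which holds because 1/50 +
    1/1000 + 2/1000 < 1/42. *)
Lemma copies_failure_le :
  1 - 100 / (t%:R * delta) <= 1 - (1 - (2 * C)%:R^-1) ^+ (s.+1 ^ k) :> R.
Proof.
have [dl0 dl dg dl21 tg] := bounds.
set T := t%:R * delta.
have T200 : 200 <= T by [].
have C0 : 0 < C%:R :> R by rewrite ltr0n bin_gt0 leq_addl.
pose z := T / 100 - 1.
have -> : 1 - 100 / T = z / (1 + z) by rewrite /z; field; lra.
apply: (@one_sub_exp_ge _ _ _ (2 * C)%:R^-1) => //.
- rewrite invr_ge0 ler0n invf_le1 ?ler1n ?ltr0n ?muln_gt0 ?bin_gt0 ?leq_addl //.
- by rewrite /z; lra.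
rewrite natrX expb ler_pdivlMr ?natrM ?mulr_gt0 //.
have sZ0 : 0 < s%:R ^+ Z :> R by rewrite exprn_gt0 // ltr0n.
have z0 : 0 <= z by rewrite /z; lra.
rewrite -(ler_pM2r sZ0).
apply: le_trans (_ : z * (expR b * expR ((Z + M)%:R * b)) <= _).
  rewrite -!mulrA ler_wpM2l //; apply: ler_pM => //.
apply: le_trans (_ : expR (k%:R * b) * expR (Z%:R * (b * (1 - 2 / s%:R))) <= _); last first.
  by rewrite ler_wpM2l ?expR_ge0.
(* The term [- 2 * b] pays for the factor 2 in [2 * C] and for the [+ 1] in [M_le]. *)
have z_le : z <= expR (T / 50 * b - 2 * b).
  apply: le_trans (expR_ge1Dx _); have := b_ge; rewrite /z; nra.
apply: le_trans (_ : expR (T / 50 * b - 2 * b) * (expR b * expR ((Z + M)%:R * b)) <= _).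
  by rewrite ler_wpM2r // mulr_ge0 ?expR_ge0.
rewrite -!expRD ler_expR natrD ZE.
have := k_ge; have := M_le; have := t_div_s_le; rewrite -/T => h1 h2 h3.
set rs := s%:R^-1.
have rs0 : 0 <= rs by rewrite invr_ge0.
have tr : t%:R * rs <= T / 1000 by [].
have kr : 0 <= k%:R * rs by rewrite mulr_ge0.
have -> : T / 50 * b - 2 * b + (b + (t%:R - 3 * k%:R + M%:R) * b) =
  b * (T / 50 - 1 + t%:R - 3 * k%:R + M%:R) by ring.
have -> : k%:R * b + (t%:R - 3 * k%:R) * (b * (1 - 2 * rs)) =
  b * (t%:R - 2 * k%:R - 2 * (t%:R * rs) + 6 * (k%:R * rs)) by ring.
rewrite ler_pM2l; last by have := b_ge; lra.
lra.
Qed.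

End Asymptotics.

Theorem theorem1p9 (R : realType) :
  exists s0 : nat, forall s : nat, (s0 <= s)%N ->
  forall c : R, 1 / 3 < c ->
    (fun t : nat =>
       let G := box (fun _ : 'I_t => star s) in
       percolation_prob G (c / t%:R)
         (fun H : sgraph =>
            (#|G|%:R : R) `^ (1 - s%:R `^ (- (1 / 6)))
              <= (largest_component_order H)%:R))
    @ \oo --> (1 : R).
Proof.
(* [K] is known only through [KE], so [K ^+ 6] stays symbolic. The threshold [s > 1000 ^ 6] amounts
   to [delta < 1 / 1000]. *)
have [K KE] : {K : R | K = 1000} by exists 1000.
have K0 : 0 < K by rewrite KE ltr0n.
pose B : R := K ^+ 6.
have B0 : 0 <= B by rewrite exprn_ge0 // ltW.
exists (Num.trunc B).+1 => s s_big c c_gt.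
have sB : B < s%:R.
  have /andP[_ Blt] := trunc_itv B0.
  by apply: lt_le_trans Blt _; rewrite ler_nat.
have sr0 : 0 < s%:R :> R by apply: le_lt_trans sB.
have s_gt0 : (0 < s)%N by rewrite -(ltr0n R).
set delta := s%:R `^ (- (1 / 6)).
have delta_gt0 : 0 < delta by apply: powR_gt0.
have s_delta : s%:R * delta ^+ 6 = 1.
  rewrite -powR_mulrn ?ltW // -powRrM (_ : - (1 / 6) * 6%:R = - 1); last by field.
  by rewrite powR_inv1 ?ltW // mulfV ?gt_eqF.
have delta_le : delta <= 1 / 1000.
  rewrite leNgt; apply/negP => delta_gt.
  have : 1 < B * delta ^+ 6.
    rewrite /B -exprMn exprn_egt1 //.
    have : K * K^-1 < K * delta by rewrite ltr_pM2l // KE -div1r.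
    by rewrite mulfV // gt_eqF.
  rewrite -s_delta ltr_pM2r ?exprn_gt0 // => /(lt_trans sB).
  by rewrite ltxx.
(* Rounding [20 / delta] up gives [20 <= d * delta <= 20 + delta], so [k = t %/ d] is about
   [delta * t / 20]. *)
pose d := (Num.trunc (20 / delta)).+1.
have q0 : 0 <= 20 / delta by rewrite divr_ge0 // ltW.
have /andP[d1 d2] := trunc_itv q0.
have d_ge : 20 <= d%:R * delta by rewrite -ler_pdivrMr // ltW.
have d_le : d%:R * delta <= 21.
  have : (Num.trunc (20 / delta))%:R * delta <= 20 by rewrite -ler_pdivlMr.
  rewrite /d -natr1 mulrDl mul1r; lra.
apply: (@squeeze_cvgr _ _ _ _ (fun t : nat => 1 - 100 / (t%:R * delta)) (fun=> 1)).
- near=> t.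
  have t_ge : 200 <= t%:R * delta.
    rewrite -ler_pdivrMr // ltW //; near: t; exact: nbhs_infty_gtr.
  (* From here on [c / t] is at most 1, hence a genuine probability. *)
  have tc : c <= t%:R by rewrite ltW //; near: t; exact: nbhs_infty_gtr.
  have t0 : 0 < t%:R :> R by apply: lt_le_trans tc; lra.
  have p_ge : (3 * t)%:R^-1 <= c / t%:R.
    rewrite natrM invfM ler_pM2r ?invr_gt0 //; lra.
  have p_le1 : c / t%:R <= 1 by rewrite ler_pdivrMr // mul1r.
  have p_ge0 : 0 <= c / t%:R by rewrite divr_ge0 //; lra.
  cbv zeta; apply/andP; split; last by rewrite percolation_probE pr_le1.
  pose k := (t %/ d)%N; pose M := ((156 * d ^ 2 * t) %/ s).+1.
  rewrite card_star_box.
  apply: le_trans (copies_failure_le delta_gt0 delta_le s_delta d_ge d_le t_ge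
    (erefl k) (erefl M)) _.
  apply: percolation_prob_ge => //.
  + exact: (scratch_blocks_fit delta_gt0 delta_le d_ge d_le t_ge).
  + exact: (detour_parameter_ge delta_gt0 delta_le s_delta d_ge d_le t_ge).
  + exact: (component_threshold_le delta_gt0 delta_le s_delta d_ge d_le t_ge).
- rewrite -[X in _ --> X]subr0; apply: cvgB; first exact: cvg_cst.
  rewrite -[X in _ --> X](mulr0 (100 / delta)).
  have -> : (fun t : nat => 100 / (t%:R * delta)) =
            (fun t : nat => 100 / delta * t%:R^-1) :> (nat -> R).
    by apply/funext => t; rewrite invfM mulrA mulrAC.
  apply: cvgM; first exact: cvg_cst.
  apply/gtr0_cvgV0; last exact: cvgr_idn.
  by near=> t; rewrite ltr0n; near: t; exact: nbhs_infty_gt.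
- exact: cvg_cst.
Unshelve. all: by end_near.
Qed.
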